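(* Let $U=\{u_1,u_2\}$ be a two-element set, with its two partitions taken in the order $(C,D)$, where $C=\{\{u_1,u_2\}\}$ and $D=\{\{u_1\},\{u_2\}\}$. For $t\neq0,1$, the matrix $T_2(t)$ is invertible and $$B_2(t)=T_2(t)^{-1}=\frac1{t^2(t-1)}\begin{pmatrix}t^2&-t\\-t&t\end{pmatrix}.$$ Equivalently, $$B_2(t)=\begin{pmatrix}\frac1{t-1}&-\frac1{t(t-1)}\\-\frac1{t(t-1)}&\frac1{t(t-1)}\end{pmatrix}.$$
   Context: Here $t$ is an element of a field (for example a complex number, or an indeterminate regarded as an element of a field of rational functions). For a finite set $U$ with $n$ elements, let $\Pi(U)=\{\pi_1,\ldots,\pi_m\}$ be the set of its set partitions, in a chosen order. For $\pi,\sigma\in\Pi(U)$, $\rho(\pi,\sigma)$ is the number of blocks of the smallest equivalence relation on $U$ containing the equivalence relations represented by both $\pi$ and $\sigma$. The splitting matrix is $T_n(t)=\bigl(t^{\rho(\pi_i,\pi_j)}\bigr)_{i,j}$, and $B_n(t)$ denotes its inverse $T_n(t)^{-1}$ when it exists. *)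

(* Defs.v *)
From mathcomp Require Import all_boot all_algebra.

Set Implicit Arguments.
Unset Strict Implicit.
Unset Printing Implicit Defensive.

Import GRing.Theory.
Local Open Scope ring_scope.

Definition set_partitions (U : finType) : {set {set {set U}}} :=
  [set P | partition P [set: U]].

Definition partition_rel (U : finType) (P : {set {set U}}) : rel U :=
  fun x y => y \in pblock P x.

Definition partition_join_rel (U : finType) (P Q : {set {set U}}) : rel U :=
  connect (fun x y => partition_rel P x y || partition_rel Q x y).

(* For partitions P and Q, partition_join_rel P Q is the smallest equivalence
   relation containing those of P and Q: the next three lemmas. *)
Lemma partition_join_rel_equiv (U : finType) (P Q : {set {set U}}) :
  P \in set_partitions U -> Q \in set_partitions U ->
  equivalence_rel (partition_join_rel P Q).
Proof.
have sym R : R \in set_partitions U -> symmetric (partition_rel R).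
  rewrite inE => /and3P[/eqP covR tiR _] x y; rewrite /partition_rel.
  by rewrite -!eq_pblock ?covR ?inE // eq_sym.
move=> PP PQ; apply/equivalence_relP; split; first by move=> x; apply: connect0.
have csym : connect_sym
    (fun x y => partition_rel P x y || partition_rel Q x y).
  by apply: sym_connect_sym => x y; rewrite (sym P) // (sym Q).
by move=> x y xy z; apply: (same_connect csym).
Qed.

Lemma partition_join_rel_sub (U : finType) (P Q : {set {set U}}) (x y : U) :
  partition_rel P x y || partition_rel Q x y -> partition_join_rel P Q x y.
Proof. by move=> xy; apply: connect1. Qed.

Lemma partition_join_rel_min (U : finType) (P Q : {set {set U}}) (e : rel U) :
  equivalence_rel e ->
  subrel (partition_rel P) e -> subrel (partition_rel Q) e ->
  subrel (partition_join_rel P Q) e.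
Proof.
move=> /equivalence_relP[re te] sP sQ x y /connectP[p + ->].
elim: p x => [|z p IHp] x /=; first by move=> _; apply: re.
case/andP=> xz /IHp zy; rewrite (te x z) //.
by case/orP: xz => [/sP|/sQ].
Qed.

Definition rho (U : finType) (P Q : {set {set U}}) : nat :=
  #|equivalence_partition (partition_join_rel P Q) [set: U]|.

(* s lists all the set partitions of U, each exactly once. *)
Definition is_partition_order (U : finType) (m : nat)
    (s : m.-tuple {set {set U}}) : Prop :=
  uniq s /\ s =i set_partitions U.

(* The tuple s is meant to satisfy is_partition_order. *)
Definition splitting_mx (F : fieldType) (U : finType) (m : nat)
    (s : m.-tuple {set {set U}}) (t : F) : 'M[F]_m :=
  \matrix_(i, j) t ^+ rho (tnth s i) (tnth s j).

(* invmx is the inverse only when splitting_mx s t \in unitmx. *)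
Definition inv_splitting_mx (F : fieldType) (U : finType) (m : nat)
    (s : m.-tuple {set {set U}}) (t : F) : 'M[F]_m :=
  invmx (splitting_mx s t).

(* The matrix with rows (a, b) and (c, d). *)
Definition mx22 (F : fieldType) (a b c d : F) : 'M[F]_2 :=
  \matrix_(i, j) if i == 0 then (if j == 0 then a else b)
                 else (if j == 0 then c else d).

(* Main.v *)
Require Import Defs.
From mathcomp Require Import all_boot all_algebra.
From mathcomp Require Import ring.

Set Implicit Arguments.
Unset Strict Implicit.
Unset Printing Implicit Defensive.

Import GRing.Theory.
Local Open Scope ring_scope.

(** A partition of a two-element set either puts both points in one block, so
    that it is the coarsest partition C, or separates them, so that it is the
    finest partition D ([partition_pair]). Joining anything with C gives C,
    which has one block, while D joined with itself is D, which has as many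
    blocks as there are points ([rho_coarsestl], [rho_finest]). The splitting
    matrix is therefore ((t, t), (t, t ^ 2)), of determinant t ^ 2 (t - 1), and
    the usual adjugate formula for 2 x 2 matrices gives the inverse. *)

Lemma partition_rel_setT (U : finType) (x y : U) :
  partition_rel [set [set: U]] x y.
Proof.
rewrite /partition_rel (def_pblock (B := [set: U])) ?inE //.
by apply/trivIsetP => A B /set1P -> /set1P ->; rewrite eqxx.
Qed.

Lemma rho_sym (U : finType) (P Q : {set {set U}}) : rho P Q = rho Q P.
Proof.
congr #|pred_of_set _|; apply: eq_imset => x; apply/setP=> y; rewrite !inE.
by apply: eq_connect => a b; rewrite orbC.
Qed.

(** The one-block partition already relates all points, so joining with it
    leaves nothing to separate; [x0] excludes the empty set, which has no
    classes. *)
Lemma rho_coarsestl (U : finType) (x0 : U) (Q : {set {set U}}) :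
  rho [set [set: U]] Q = 1%N.
Proof.
have joinT x y : partition_join_rel [set [set: U]] Q x y.
  by apply: partition_join_rel_sub; rewrite partition_rel_setT.
apply/eqP/cards1P; exists [set: U]; apply/setP=> A; rewrite inE.
apply/imsetP/eqP => [[x _ ->]|->].
  by apply/setP=> y; rewrite !inE joinT.
by exists x0 => //; apply/setP=> y; rewrite !inE joinT.
Qed.

(** Equality is an equivalence relation containing that of the partition into
    singletons, so by minimality the join of this partition with itself adds
    nothing, and each point is alone in its class. *)
Lemma rho_finest (U : finType) (D : {set {set U}}) :
  D = [set [set x] | x in [set: U]] -> rho D D = #|U|.
Proof.
move=> defD; have pblockD x : pblock D x = [set x].
  apply: def_pblock; rewrite ?set11 ?defD ?imset_f //.
  apply/trivIsetP => _ _ /imsetP[a _ ->] /imsetP[b _ ->] ab.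
  by rewrite disjoints1 inE; apply: contraNneq ab => ->.
have joinD x y : partition_join_rel D D x y = (x == y).
  apply/idP/eqP => [|->]; last exact: connect0.
  have eq_equiv : equivalence_rel (@eq_op U).
    by apply/equivalence_relP; split=> // a b /eqP -> c.
  by move/(partition_join_rel_min eq_equiv) => h; apply/eqP/h => a b;
    rewrite /partition_rel pblockD inE eq_sym.
rewrite /rho /equivalence_partition -cardsT card_imset // => x y /setP/(_ y).
by rewrite !inE !joinD eqxx => /eqP.
Qed.

(** An equivalence relation on a pair of points is determined by whether it
    relates them. As every partition comes from an equivalence relation, this
    one computation both restricts the possible partitions of a pair and shows
    that the two candidates are partitions. *)
Lemma equivalence_partition_pair (T : finType) (e : rel T) (x y : T) :
  {in [set x; y] & &, equivalence_rel e} ->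
  equivalence_partition e [set x; y] =
    if e x y then [set [set x; y]] else [set [set x]; [set y]].
Proof.
move=> eqe; have [xA yA] : x \in [set x; y] /\ y \in [set x; y].
  by rewrite !inE !eqxx orbT.
have [exx trx] := eqe x y x xA yA xA.
have [eyy _] := eqe y y y yA yA yA.
have exy : e x y = e y x by apply/idP/idP => [/trx <-|]//;
  have [_ tr] := eqe y x y yA xA yA => /tr <-.
rewrite /equivalence_partition imsetU1 imset_set1.
have caseA w : (w \in [set x; y]) = (w == x) || (w == y) by rewrite !inE.
case: ifP => rxy.
  have block z : e z x && e z y -> [set w in [set x; y] | e z w] = [set x; y].
    move=> /andP[zx zy]; apply/setP=> w; rewrite inE caseA.
    by have [->|_] := eqVneq w x; last have [->|_] := eqVneq w y.
  by rewrite !block ?setUid // ?exx ?eyy -?exy rxy.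
have xy : x != y by apply: contraFneq rxy => <-.
by congr ([set _] :|: [set _]); apply/setP=> w; rewrite inE caseA inE;
  (have [->|nx] := eqVneq w x; last have [->|ny] := eqVneq w y);
  rewrite /= ?exx ?eyy -?exy ?rxy ?(negPf xy) ?eqxx.
Qed.

Lemma partition_pair (T : finType) (P : {set {set T}}) (x y : T) : x != y ->
  partition P [set x; y] =
    (P == [set [set x; y]]) || (P == [set [set x]; [set y]]).
Proof.
move=> xy; apply/idP/orP => [PA|[]/eqP ->].
- rewrite -(equivalence_partition_pblock PA).
  rewrite (equivalence_partition_pair (pblock_equivalence PA)).
  by case: ifP => _; [left | right].
(* The one-block partition comes from the total relation, and the partition
   into singletons from equality. *)
- have eqT : {in [set x; y] & &, equivalence_rel (fun _ _ : T => true)} by [].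
  by have := equivalence_partitionP eqT; rewrite equivalence_partition_pair.
- have eqT : {in [set x; y] & &, equivalence_rel (@eq_op T)}.
    by move=> a b c _ _ _; split=> // /eqP ->.
  have := equivalence_partitionP eqT.
  by rewrite equivalence_partition_pair // (negPf xy).
Qed.

Lemma mulmx22 (F : fieldType) (a b c d a' b' c' d' : F) :
  mx22 a b c d *m mx22 a' b' c' d' =
  mx22 (a * a' + b * c') (a * b' + b * d') (c * a' + d * c') (c * b' + d * d').
Proof.
by apply/matrixP=> i j; rewrite !mxE big_ord_recl big_ord1 !mxE;
  case: (i == 0); case: (j == 0).
Qed.

Lemma scalar_mx22 (F : fieldType) (a : F) : a%:M = mx22 a 0 0 a.
Proof.
by apply/matrixP=> i j; rewrite !mxE; case: i => [[|[]]] //= ?;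
  case: j => [[|[]]].
Qed.

Lemma scalemx22 (F : fieldType) (k a b c d : F) :
  k *: mx22 a b c d = mx22 (k * a) (k * b) (k * c) (k * d).
Proof.
by apply/matrixP=> i j; rewrite !mxE; case: (i == 0); case: (j == 0).
Qed.

Theorem proposition6p2 (F : fieldType) (t : F) (U : finType) (u1 u2 : U)
    (u1_neq_u2 : u1 != u2) (U_def : [set: U] = [set u1; u2])
    (t_neq0 : t != 0) (t_neq1 : t != 1) :
  let C : {set {set U}} := [set [set u1; u2]] in
  let D : {set {set U}} := [set [set u1]; [set u2]] in
  let s : 2.-tuple {set {set U}} := [tuple C; D] in
  [/\ is_partition_order s,
      splitting_mx s t \in unitmx,
      inv_splitting_mx s t =
        (t ^+ 2 * (t - 1))^-1 *: mx22 (t ^+ 2) (- t) (- t) t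
    & inv_splitting_mx s t =
        mx22 (t - 1)^-1 (- (t * (t - 1))^-1)
             (- (t * (t - 1))^-1) (t * (t - 1))^-1].
Proof.
move=> C D s; have t1_neq0 : t - 1 != 0 by rewrite subr_eq0.
have cardU : #|U| = 2%N by rewrite -cardsT U_def cards2 u1_neq_u2.
have rhoC Q : rho C Q = 1%N by rewrite /C -U_def (rho_coarsestl u1).
have rhoD : rho D D = 2%N.
  by rewrite rho_finest // U_def imsetU1 imset_set1.
have TE : splitting_mx s t = mx22 t t t (t ^+ 2).
  by apply/matrixP=> i j; rewrite !mxE; case: i => [[|[]]] //= ?;
    case: j => [[|[]]] //= ?; rewrite !(tnth_nth C) /=
      ?rhoC ?rhoD ?(rho_sym D C) ?rhoC ?expr1.
set B := mx22 (t - 1)^-1 (- (t * (t - 1))^-1)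
              (- (t * (t - 1))^-1) (t * (t - 1))^-1.
have BE : (t ^+ 2 * (t - 1))^-1 *: mx22 (t ^+ 2) (- t) (- t) t = B.
  by rewrite scalemx22 /B; congr (mx22 _ _ _ _); field; rewrite t1_neq0 t_neq0.
have TB : splitting_mx s t *m B = 1%:M.
  by rewrite TE mulmx22 scalar_mx22; congr (mx22 _ _ _ _); field; rewrite t1_neq0 t_neq0.
have [uT _] := mulmx1_unit TB.
have invT : inv_splitting_mx s t = B by rewrite -[RHS](mulKmx uT) TB mulmx1.
split=> //; last by rewrite BE.
split=> [|P]; last by rewrite !inE U_def partition_pair.
(* C and D differ because their joins with D have different numbers of blocks. *)
rewrite /= mem_seq1 andbT; apply/eqP => CD.
by have := rhoC D; rewrite CD rhoD.
Qed.
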